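(* Let $G=(V,w,m)$ be a finite weighted graph, let $R\ge1$ be an integer, and let $K\in\mathbb{R}$. The following are equivalent: (i) For all $x,y\in V$ with $d(x,y)\le R$ we have $K^e_R(x,y)\ge K$. (ii) For all positive $f:V\to(0,\infty)$ and all $t\ge0$, $$\|\nabla_R\log P_tf\|_\infty\le e^{-Kt}\,\|\nabla_R\log f\|_\infty .$$
   Context: A weighted graph $G=(V,w,m)$ consists of a vertex set $V$, symmetric edge weights $w:V\times V\to[0,\infty)$ and a vertex measure $m:V\to(0,\infty)$; $x\sim y$ (an edge, $x\neq y$) iff $w(x,y)>0$. Simple graphs are the case $w\in\{0,1\}$, $m\equiv1$. $d(x,y)$ is the combinatorial (path) distance. Laplacian: $\Delta f(x)=\frac1{m(x)}\sum_y w(x,y)(f(y)-f(x))$. $P_t=e^{t\Delta}$ is the heat semigroup. $R$-gradient: $|\nabla_R f|(x)=\max_{d(x,y)\le R}|f(y)-f(x)|$ and $\|\nabla_R f\|_\infty=\sup_{x\in V}|\nabla_Rf|(x)$. Exponential Gradient-Ollivier curvature: $$K_R^e(x,y)=\inf_{r>0}\frac1r\inf\Big\{\frac{\Delta\exp(g)}{\exp(g)}(x)-\frac{\Delta\exp(g)}{\exp(g)}(y)\Big\},$$ the inner infimum being over all $g:V\to\mathbb{R}$ with $\|\nabla_Rg\|_\infty=r$ and $g(y)-g(x)=r$ (with $\inf\emptyset=+\infty$). *)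

(* Defs.v *)
From mathcomp Require Import all_boot all_order all_algebra.
From mathcomp Require Import all_classical all_reals all_analysis.
Import Order.TTheory GRing.Theory Num.Theory.
Import numFieldNormedType.Exports.

Set Implicit Arguments.
Unset Strict Implicit.
Unset Printing Implicit Defensive.

Local Open Scope classical_set_scope.
Local Open Scope ring_scope.

Record weighted_graph (R : realType) (V : finType) := WeightedGraph {
  weight : V -> V -> R ;
  measure_of : V -> R ;
  weight_sym : forall x y, weight x y = weight y x ;
  weight_ge0 : forall x y, 0 <= weight x y ;
  measure_of_gt0 : forall x, 0 < measure_of x }.

Definition adjacent (R : realType) (V : finType) (G : weighted_graph R V) :
    rel V :=
  fun x y => (x != y) && (0 < weight G x y).

(* G is not assumed to be connected: the distance between two vertices of
   distinct components is +oo, the infimum of the empty set. *)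
Definition graph_dist (R : realType) (V : finType) (G : weighted_graph R V)
    (x y : V) : \bar R :=
  ereal_inf [set (size p)%:R%:E | p in
    [set p : seq V | path (adjacent G) x p /\ last x p = y]].

Definition laplacian (R : realType) (V : finType) (G : weighted_graph R V)
    (f : V -> R) : V -> R :=
  fun x => (measure_of G x)^-1 * \sum_(y : V) weight G x y * (f y - f x).

(* The exponential series of t Delta, evaluated pointwise; Delta is a linear
   operator of a finite-dimensional space, so the series converges. *)
Definition heat_semigroup (R : realType) (V : finType)
    (G : weighted_graph R V) (t : R) (f : V -> R) : V -> R :=
  fun x => limn (series (fun k : nat =>
    t ^+ k / k`!%:R * iter k (laplacian G) f x)).

(* In this maximum and the next one, the default value 0 is immaterial: the
   maximised quantities are nonnegative, and y = x is in the range here. *)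
Definition grad (R : realType) (V : finType) (G : weighted_graph R V)
    (n : nat) (f : V -> R) (x : V) : R :=
  \big[Num.max/0]_(y : V | (graph_dist G x y <= n%:R%:E)%E) `|f y - f x|.

Definition grad_norm (R : realType) (V : finType) (G : weighted_graph R V)
    (n : nat) (f : V -> R) : R :=
  \big[Num.max/0]_(x : V) grad G n f x.

Definition log_laplacian (R : realType) (V : finType) (G : weighted_graph R V)
    (g : V -> R) (x : V) : R :=
  laplacian G (fun z => expR (g z)) x / expR (g x).

Definition exp_curvature (R : realType) (V : finType) (G : weighted_graph R V)
    (n : nat) (x y : V) : \bar R :=
  ereal_inf [set (r^-1%:E * ereal_inf
      [set (log_laplacian G g x - log_laplacian G g y)%:E | g in
        [set g : V -> R | grad_norm G n g = r /\ (g y - g x)%R = r]])%E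
    | r in [set r : R | 0 < r]].

(* Main.v *)
Require Import Defs.
From mathcomp Require Import all_boot all_order all_algebra.
From mathcomp Require Import all_classical all_reals all_analysis.
From mathcomp Require Import ring lra.
Import Order.TTheory GRing.Theory Num.Theory.
Import numFieldNormedType.Exports.

Local Open Scope classical_set_scope.
Local Open Scope ring_scope.

(** The functions g_t = log P_t f satisfy dg_t/dt = e^{-g_t} Delta e^{g_t}.
    The norm of the R-gradient of g_t is the maximum of g_t(y) - g_t(x) over
    the pairs (x, y) at distance at most R, and the curvature bound says
    exactly that, at a pair realising this maximum N(t), the time derivative
    of g_t(y) - g_t(x) is at most -K N(t).  A maximum principle for finite
    families of differentiable functions, applied to e^{Kt} (g_t(y) - g_t(x)),
    turns this into the decay of N.  Conversely, if f = e^g and g(y) - g(x) is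
    the gradient norm of g, then both sides of the gradient estimate agree at
    t = 0, and differentiating it there gives the curvature bound. *)

(** * One-sided derivative tests and a maximum principle for finite families *)

Section OneSidedMaximum.
Context {R : realType}.
Implicit Types (f : R -> R) (a b d s : R).

Lemma is_derive_left_max f a s d : is_derive s 1 f d -> a < s ->
  (forall t, a <= t <= s -> f t <= f s) -> 0 <= d.
Proof.
move=> [df fd] as_ fmax.
have : h^-1 *: (f (h *: (1 : R) + s) - f s) @[h --> 0^'-] --> d.
  by apply: cvg_dnbhs_at_left; rewrite -fd; exact: df.
move/cvgr_to_ge; apply.
near=> h.
have h0 : h < 0 by near: h; exact: nbhs_left_lt.
have ha : a - s < h by near: h; apply: nbhs_left_gt; rewrite subr_lt0.
apply: mulr_le0; first by rewrite invr_le0 ltW.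
by rewrite subr_le0; apply: fmax; rewrite [_%:A]mulr1; lra.
Unshelve. all: by end_near. Qed.

Lemma is_derive_right_max f b s d : is_derive s 1 f d -> s < b ->
  (forall t, s <= t <= b -> f t <= f s) -> d <= 0.
Proof.
move=> [df fd] sb fmax.
have : h^-1 *: (f (h *: (1 : R) + s) - f s) @[h --> 0^'+] --> d.
  by apply: cvg_dnbhs_at_right; rewrite -fd; exact: df.
move/cvgr_to_le; apply.
near=> h.
have h0 : 0 < h by near: h; exact: nbhs_right_gt.
have hb : h < b - s by near: h; apply: nbhs_right_lt; rewrite subr_gt0.
apply: mulr_ge0_le0; first by rewrite invr_ge0 ltW.
by rewrite subr_le0; apply: fmax; rewrite [_%:A]mulr1; lra.
Unshelve. all: by end_near. Qed.

(** The sign of the derivative is asked only at indices attaining the maximum at that time, the only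
    place where a curvature bound or the sign of a Laplacian is available. It serves both the
    positivity of the heat semigroup and the gradient decay. *)
Lemma max_principle (I : finType) (P : pred I) (u u' : I -> R -> R) (M : R) :
  (forall i (t : R), P i -> 0 <= t -> is_derive t 1 (u i) (u' i t)) ->
  (forall i (t : R), P i -> 0 < t -> (forall j, P j -> u j t <= u i t) ->
    u' i t <= 0) ->
  (forall i, P i -> u i 0 <= M) ->
  forall i (t : R), P i -> 0 <= t -> u i t <= M.
Proof.
move=> du u'le0 u0M i0 T Pi0; rewrite le_eqVlt => /predU1P[<-|T0].
  exact: u0M.
rewrite leNgt; apply/negP => MuT.
(* Subtracting e t makes the derivatives at the maximal indices strictly
   negative, so that a maximum over the indices and [0, T] sits at time 0. *)
pose e := (u i0 T - M) / (2 * T).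
have e0 : 0 < e by rewrite divr_gt0 ?mulr_gt0// subr_gt0.
pose w i (t : R) := u i t - e * t.
have dw i (t : R) : P i -> 0 <= t -> is_derive t 1 (w i) (u' i t - e).
  move=> Pi t0; have ? := du _ _ Pi t0.
  by apply: is_derive_eq; rewrite /GRing.scale/= mulr1.
have /choice[c cP] i : exists c, P i -> c \in `[0, T] /\
    forall t, t \in `[0, T] -> w i t <= w i c.
  have [Pi|_] := boolP (P i); last by exists 0.
  have [|c cT wc] := @EVT_max R (w i) 0 T (ltW T0); last by exists c.
  apply: derivable_within_continuous => t; rewrite in_itv/= => /andP[t0 _].
  by have [] := dw _ _ Pi t0.
have [i Pi imax] := @arg_maxP _ R I i0 P (fun i => w i (c i)) Pi0.
have [] := cP _ Pi; rewrite in_itv/= => /andP[ci0 ciT] wimax.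
have wM : M < w i (c i).
  apply: (@lt_le_trans _ _ (w i0 T)).
    have -> : w i0 T = (u i0 T + M) / 2 by rewrite /w/e; field; rewrite gt_eqF.
    by lra.
  apply: le_trans (imax _ Pi0).
  by have [_ ->] := cP _ Pi0 => //; rewrite in_itv/= lexx ltW.
have [ci00|ci_gt0] := eqVneq (c i) 0.
  by have := u0M _ Pi; move: wM; rewrite /w ci00; lra.
have {}ci_gt0 : 0 < c i by rewrite lt_neqAle eq_sym ci_gt0.
(* Only times before [c i] are compared, so [c i = T] is allowed. *)
have : 0 <= u' i (c i) - e.
  apply: (is_derive_left_max _ _ _ _ (dw _ _ Pi ci0) ci_gt0) => t /andP[t0 tc].
  by apply: wimax; rewrite in_itv/= t0 (le_trans tc).
have : u' i (c i) <= 0.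
  apply: u'le0 => // j Pj.
  have : w j (c i) <= w i (c i).
    apply: le_trans (imax _ Pj).
    by have [_ ->] := cP _ Pj => //; rewrite in_itv/= ci0.
  by rewrite /w lerD2r.
by lra.
Qed.

End OneSidedMaximum.

(** * The heat semigroup: convergence, heat equation, positivity *)

Section HeatSemigroup.
Context {R : realType} {V : finType} (G : weighted_graph R V).
Implicit Types (f g : V -> R) (t : R) (x y z : V).

Lemma laplacian_bound : exists2 C : R, 0 <= C &
  forall f (M : R), (forall x, `|f x| <= M) ->
  forall x, `|laplacian G f x| <= C * M.
Proof.
pose D x := (measure_of G x)^-1 * \sum_y weight G x y * 2.
have D0 x : 0 <= D x.
  rewrite mulr_ge0 ?invr_ge0 ?(ltW (measure_of_gt0 _ _))// sumr_ge0// => y _.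
  by rewrite mulr_ge0 ?weight_ge0.
(* The sum over the finite set [V] dominates every local constant [D x]. *)
exists (\sum_x D x) => [|f M fM x]; first by rewrite sumr_ge0.
have M0 : 0 <= M by exact: le_trans (normr_ge0 _) (fM x).
apply: (@le_trans _ _ (D x * M)); last first.
  by rewrite ler_wpM2r// (bigD1 x)//= lerDl sumr_ge0.
rewrite /laplacian /D normrM gtr0_norm ?invr_gt0 ?measure_of_gt0// -mulrA.
rewrite ler_pM2l ?invr_gt0 ?measure_of_gt0// mulr_suml.
rewrite (le_trans (ler_norm_sum _ _ _))// ler_sum// => y _.
rewrite normrM (ger0_norm (weight_ge0 _ _ _)) -mulrA ler_wpM2l ?weight_ge0//.
rewrite (le_trans (ler_normB _ _))//.
by have := fM x; have := fM y; lra.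
Qed.

(** Coefficients of the heat series as a power series in [t], so that termwise differentiation
    applies; it replaces [f] by [laplacian G f]. *)
Let coef f x k : R := iter k (laplacian G) f x / k`!%:R.

Let heatE f t x : heat_semigroup G t f x = limn (pseries (coef f x) t).
Proof.
rewrite /heat_semigroup /pseries; congr (limn (series _)).
by apply/funext => k; rewrite /coef mulrC mulrA mulrAC.
Qed.

Let coef_diffs f x : pseries_diffs (coef f x) = coef (laplacian G f) x.
Proof.
apply/funext => k; rewrite /pseries_diffs /coef -iterSr factS natrM.
by rewrite invfM mulrCA mulVKf ?pnatr_eq0.
Qed.

(** Boundedness of the Laplacian dominates the terms by [M] times those of the exponential series at
    [C * |t|]. *)
Let is_cvg_heat f x t : cvgn (pseries (coef f x) t).
Proof.
have [C C0 CP] := laplacian_bound.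
pose M := \sum_y `|f y|.
have iterP k z : `|iter k (laplacian G) f z| <= C ^+ k * M.
  elim: k z => [|k IH] z /=.
    by rewrite expr0 mul1r /M (bigD1 z)//= lerDl sumr_ge0.
  by rewrite exprS -mulrA; apply: CP.
apply: normed_cvg.
apply: (@series_le_cvg _ _ (fun k => M * exp_coeff (C * `|t|) k)) => [k|k|k|].
- by rewrite /=.
- rewrite /= mulr_ge0// ?sumr_ge0//; apply: exp_coeff_ge0.
  by rewrite mulr_ge0.
- rewrite /= /exp_coeff /= /coef !normrM normrX normfV normr_nat.
  rewrite [leRHS](_ : _ = C ^+ k * M / k`!%:R * `|t| ^+ k).
    by rewrite ler_wpM2r// ?exprn_ge0// ler_wpM2r// invr_ge0.
  by rewrite exprMn -mulrA (mulrC k`!%:R^-1) mulrACA mulrCA -!mulrA.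
- by apply: (@is_cvg_seriesZ _ _ M); exact: is_cvg_series_exp_coeff.
Qed.

Lemma heat_semigroup0 f x : heat_semigroup G 0 f x = f x.
Proof.
rewrite heatE; apply: cvg_lim => //; rewrite -cvg_shiftS /=.
apply: cvg_near_cst; near=> k.
rewrite /pseries /series /= big_nat_recl// big1 => [|i _].
  by rewrite /coef/= expr0 mulr1 divr1 addr0.
by rewrite expr0n mulr0.
Unshelve. all: by end_near. Qed.

(** The Laplacian is a finite linear combination of point values, so it passes through partial sums
    and their limit. *)
Let heat_laplacian f t x :
  heat_semigroup G t (laplacian G f) x = laplacian G (heat_semigroup G t f) x.
Proof.
rewrite heatE; apply: cvg_lim => //.
rewrite [X in X @ _ --> _](_ : _ = fun k => (measure_of G x)^-1 *
    \sum_y weight G x y * (pseries (coef f y) t k - pseries (coef f x) t k)).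
  apply: cvgMl_tmp; apply: cvg_big => [|y _].
    exact: add_continuous.
  apply: cvgMl_tmp.
  by rewrite !heatE; apply: cvgB; exact: is_cvg_heat.
apply/funext => k; rewrite /pseries /series /=.
under [in RHS]eq_bigr => y _ do rewrite -sumrB mulr_sumr.
rewrite exchange_big mulr_sumr/=; apply: eq_bigr => i _.
rewrite /coef -iterSr /= {1}/laplacian -!mulrA; congr (_ * _).
by rewrite mulr_suml; apply: eq_bigr => y _; ring.
Qed.

Lemma is_derive_heat f x t : is_derive t 1
  (fun t => heat_semigroup G t f x) (laplacian G (heat_semigroup G t f) x).
Proof.
rewrite -heat_laplacian heatE -coef_diffs.
rewrite (_ : (fun t => _) = fun t => limn (pseries (coef f x) t)); last first.
  by apply/funext => ?; rewrite heatE.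
apply: (@pseries_snd_diffs _ _ (`|t| + 1)); rewrite ?coef_diffs//.
by rewrite [ltRHS]ger0_norm ?addr_ge0// ltrDl.
Qed.

(** Minimum principle: the Laplacian is nonnegative at a minimal vertex, so the values stay above
    the minimum of [f], which is positive as [V] is finite. *)
Lemma heat_semigroup_gt0 f t x :
  (forall y, 0 < f y) -> 0 <= t -> 0 < heat_semigroup G t f x.
Proof.
move=> f0 t0.
have [y _ fy] := @arg_minP _ R V x predT f isT.
suff : - heat_semigroup G t f x <= - f y by rewrite lerN2; apply: lt_le_trans (f0 y).
apply: (@max_principle _ V predT (fun x t => - heat_semigroup G t f x)
  (fun x t => - laplacian G (heat_semigroup G t f) x)) => //.
- by move=> z s _ _; have ? := is_derive_heat f z s; apply: is_deriveN.
- move=> z s _ _ zmax; rewrite oppr_le0 /laplacian.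
  rewrite mulr_ge0 ?invr_ge0 ?(ltW (measure_of_gt0 _ _))// sumr_ge0// => v _.
  by rewrite mulr_ge0 ?weight_ge0// subr_ge0 -lerN2 zmax.
- by move=> z _; rewrite heat_semigroup0 lerN2 fy.
Qed.

End HeatSemigroup.

(** * Gradient norm, curvature and the log-Laplacian *)

Section Gradient.
Context {R : realType} {V : finType} (G : weighted_graph R V) (n : nat).
Implicit Types (g : V -> R) (x y : V).

Lemma graph_distC x y : graph_dist G x y = graph_dist G y x.
Proof.
suff le_dist u v : (graph_dist G u v <= graph_dist G v u)%E.
  by apply/eqP; rewrite eq_le !le_dist.
apply: ereal_inf_le_tmp => _ [p [pp <-]] <- /=.
exists (rev (belast v p)); last by rewrite size_rev size_belast.
split; last by case: p {pp} => [//|a p] /=; rewrite rev_cons last_rcons.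
rewrite rev_path (@eq_path _ _ (Defs.adjacent G)) // => a b.
by rewrite /Defs.adjacent eq_sym weight_sym.
Qed.

Lemma adjacent_graph_dist x y : Defs.adjacent G x y -> (graph_dist G x y <= 1%:E)%E.
Proof.
by move=> xy; apply: ereal_inf_lbound; exists [:: y] => //=; rewrite xy.
Qed.

Lemma grad_norm_ge g x y :
  (graph_dist G x y <= n%:R%:E)%E -> g y - g x <= grad_norm G n g.
Proof.
move=> xy; apply: le_trans (ler_norm _) _.
apply: le_trans (le_bigmax _ _ x).
exact: (le_bigmax_cond _ (fun z => `|g z - g x|)).
Qed.

(** The distance is symmetric, so exchanging [x] and [y] recovers the absolute value from one-sided
    bounds. *)
Lemma grad_norm_le g (B : R) : 0 <= B ->
  (forall x y, (graph_dist G x y <= n%:R%:E)%E -> g y - g x <= B) ->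
  grad_norm G n g <= B.
Proof.
move=> B0 gB; apply: bigmax_le => // x _; apply: bigmax_le => // y xy.
by rewrite ler_norml gB// andbT lerNl opprB gB// graph_distC.
Qed.

(** The value [r] is determined by [g], so the nested infima merge into one over [g]; an [r] without
    admissible [g] contributes [+oo], hence no constraint. *)
Lemma le_exp_curvatureP (K : R) x y :
  (K%:E <= exp_curvature G n x y)%E <->
  (forall g, 0 < grad_norm G n g -> g y - g x = grad_norm G n g ->
    K * grad_norm G n g <= log_laplacian G g x - log_laplacian G g y).
Proof.
split=> [Kxy g g0 gxy|Kxy].
  rewrite mulrC -ler_pdivlMl// -lee_fin (le_trans Kxy)//.
  rewrite EFinM; apply: le_trans.
    by apply: ereal_inf_lbound; exists (grad_norm G n g).
  rewrite lee_pmul2l ?lte_fin ?invr_gt0//.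
  by apply: ereal_inf_lbound; exists g.
apply: le_ereal_inf_tmp => _ [r r0 <-].
rewrite lee_pdivlMl//; apply: le_ereal_inf_tmp => _ [g [gr gxy] <-].
by rewrite -EFinM lee_fin mulrC -gr; apply: Kxy; rewrite gr.
Qed.

(** As [1 <= n], neighbours are within range of the gradient, so [g] agrees with [g x] at each
    neighbour of [x]. *)
Lemma log_laplacian_eq0 g x : (1 <= n)%N -> grad_norm G n g = 0 ->
  log_laplacian G g x = 0.
Proof.
move=> n1 g0; rewrite /log_laplacian /laplacian big1 ?mulr0 ?mul0r// => y _.
have [->|xy] := eqVneq x y; first by rewrite subrr mulr0.
have := weight_ge0 G x y; rewrite le_eqVlt => /predU1P[<-|wxy].
  by rewrite mul0r.
have dxy : (graph_dist G x y <= n%:R%:E)%E.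
  apply: le_trans (adjacent_graph_dist _ _ _) _; first by rewrite /Defs.adjacent xy.
  by rewrite lee_fin ler1n.
suff -> : g y = g x by rewrite subrr mulr0.
have := grad_norm_ge g x y dxy.
have := grad_norm_ge g y x; rewrite graph_distC g0 => /(_ dxy).
by lra.
Qed.

Lemma is_derive_ln_heat (f : V -> R) x (t : R) :
  (forall y, 0 < f y) -> 0 <= t ->
  is_derive t 1 (fun t => ln (heat_semigroup G t f x))
    (log_laplacian G (fun y => ln (heat_semigroup G t f y)) x).
Proof.
move=> f0 t0; have Hgt0 := fun y => heat_semigroup_gt0 G f t y f0 t0.
have dln := is_derive1_ln (Hgt0 x).
have := is_derive1_comp dln (is_derive_heat G f x t).
move/is_derive_eq; apply.
rewrite /log_laplacian lnK ?posrE// mulrC; congr (laplacian G _ x / _).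
by apply/funext => y; rewrite lnK ?posrE.
Qed.

End Gradient.

(** * From curvature to gradient decay and back *)

Theorem theorem1p8 (R : realType) (V : finType) (G : weighted_graph R V)
    (n : nat) (hn : (1 <= n)%N) (K : R) :
  (forall x y : V,
     (graph_dist G x y <= n%:R%:E)%E -> (K%:E <= exp_curvature G n x y)%E) <->
  (forall (f : V -> R), (forall x : V, 0 < f x) -> forall t : R, 0 <= t ->
     grad_norm G n (fun x => ln (heat_semigroup G t f x)) <=
     expR (- K * t) * grad_norm G n (fun x => ln (f x))).
Proof.
split=> [curv f f0 t t0|contr x y xy].
  pose g t x := ln (heat_semigroup G t f x).
  pose L t x := log_laplacian G (g t) x.
  have N0 : 0 <= grad_norm G n (fun x => ln (f x)) by exact: bigmax_ge_id.
  apply: grad_norm_le => [|x y xy]; first by rewrite mulr_ge0 ?expR_ge0.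
  (* Moving the exponential to the left makes the bound constant in time, as the maximum principle
     requires. *)
  rewrite mulNr expRN -ler_pdivrMl ?invr_gt0 ?expR_gt0// invrK.
  pose P (p : V * V) := (graph_dist G p.1 p.2 <= n%:R%:E)%E.
  pose u (p : V * V) t := expR (K * t) * (g t p.2 - g t p.1).
  pose u' (p : V * V) t :=
    expR (K * t) * (K * (g t p.2 - g t p.1) + (L t p.2 - L t p.1)).
  apply: (@max_principle _ _ P u u' _ _ _ _ (x, y)) => //.
  - move=> p s _ s0.
    have ? := is_derive_ln_heat G f p.1 s f0 s0.
    have ? := is_derive_ln_heat G f p.2 s f0 s0.
    apply: is_derive_eq; rewrite /GRing.scale/= /u' /L /g !mulr1; ring.
  - move=> [a b] s Pab s0 abmax; rewrite /u' /=.
    rewrite pmulr_rle0 ?expR_gt0//.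
    have {}abmax c d : (graph_dist G c d <= n%:R%:E)%E ->
        g s d - g s c <= g s b - g s a.
      by move=> cd; have := abmax (c, d) cd; rewrite /u ler_pM2l ?expR_gt0.
    (* The swapped pair is also in range, so the maximal difference is at least its own opposite. *)
    have ab0 : 0 <= g s b - g s a.
      by have := abmax b a; rewrite graph_distC => /(_ Pab); lra.
    have Nab : g s b - g s a = grad_norm G n (g s).
      by apply/eqP; rewrite eq_le grad_norm_ge// grad_norm_le.
    (* The curvature only involves r > 0; if N = 0, then g is constant around
       each vertex and both log-Laplacians vanish. *)
    move: ab0; rewrite Nab le_eqVlt => /predU1P[N00|Ngt0].
      by rewrite /L -N00 !(log_laplacian_eq0 G n _ _ hn (esym N00)) mulr0 subrr addr0.
    have /le_exp_curvatureP := curv _ _ Pab.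
    by move=> /(_ _ Ngt0 Nab); rewrite /L; lra.
  - move=> [a b] Pab; rewrite /u /g mulr0 expR0 mul1r !heat_semigroup0 /=.
    exact: (grad_norm_ge G n (fun x => ln (f x))).
apply/le_exp_curvatureP => g Ngt0 gxy.
have e0 z : 0 < expR (g z) by exact: expR_gt0.
have gE s : heat_semigroup G 0 (fun z => expR (g z)) s = expR (g s).
  exact: heat_semigroup0.
pose N := grad_norm G n g.
have dx := is_derive_ln_heat G _ x 0 e0 (lexx _).
have dy := is_derive_ln_heat G _ y 0 e0 (lexx _).
(* The gradient estimate gives [h t <= 0] for [t >= 0], with equality at 0 because [g y - g x = N];
   hence the derivative of [h] at 0 is nonpositive. *)
pose h (t : R) := ln (heat_semigroup G t (fun z => expR (g z)) y)
  - ln (heat_semigroup G t (fun z => expR (g z)) x) - expR (- K * t) * N.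
have dh : is_derive (0 : R) 1 h
    (log_laplacian G g y - log_laplacian G g x + K * N).
  have lg : (fun z => ln (heat_semigroup G 0 (fun z => expR (g z)) z)) = g.
    by apply/funext => z; rewrite gE expRK.
  move: dx dy; rewrite lg => dx dy.
  by apply: is_derive_eq; rewrite /GRing.scale/= !mulr0 expR0; ring.
suff : log_laplacian G g y - log_laplacian G g x + K * N <= 0 by rewrite /N; lra.
apply: (is_derive_right_max h 1 0 _ dh ltr01) => t /andP[t0 _].
have -> : h 0 = 0 by rewrite /h !gE !expRK mulr0 expR0 gxy /N mul1r subrr.
rewrite subr_le0.
apply: le_trans (grad_norm_ge G n
  (fun z => ln (heat_semigroup G t (fun z => expR (g z)) z)) x y xy) _.
apply: le_trans (contr _ e0 t t0) _.
by rewrite (_ : (fun z => ln (expR (g z))) = g)//; apply/funext => z; rewrite expRK.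
Qed.
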